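(* For every $n\ge1$ and every partition $\lambda\vdash n$, $$|\phi(\lambda)|=\#\{w\in\mathfrak{A}_{2n}:\mathrm{rp}(\hat w)=\lambda\}.$$
   Context: For $\lambda=\langle 1^{m_1},\dots,n^{m_n}\rangle\vdash n$ ($m_k$ parts equal to $k$), $\phi(\lambda)=(2n)!\prod_{k=1}^n\frac{1}{m_k!}\left(\frac{4^k(4^k-1)B_{2k}}{(2k)(2k)!}\right)^{m_k}$, where $B_{2k}$ are Bernoulli numbers. A permutation $w=a_1a_2\cdots a_k\in\mathfrak{S}_k$ is alternating if $a_1>a_2<a_3>a_4<\cdots$; $\mathfrak{A}_k$ is the set of alternating permutations in $\mathfrak{S}_k$. For $w=a_1\cdots a_{2n}\in\mathfrak{A}_{2n}$, let $\hat w=b_1b_2\cdots b_n$ with $b_i=a_{2i-1}$. The record set $\mathrm{rec}(\hat w)$ is the set of $i\in[n]$ such that $b_i>b_j$ for all $1\le j<i$ (so $1\in\mathrm{rec}(\hat w)$). If $\mathrm{rec}(\hat w)=\{r_1<r_2<\cdots<r_j\}$, the record partition $\mathrm{rp}(\hat w)\vdash n$ is the partition with parts $r_2-r_1,r_3-r_2,\dots,r_j-r_{j-1},n+1-r_j$ arranged in weakly decreasing order. *)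

(* Defs.v *)
From HB Require Import structures.
From mathcomp Require Import all_boot all_order all_algebra all_fingroup.

Set Implicit Arguments.
Unset Strict Implicit.
Unset Printing Implicit Defensive.

Import Order.TTheory GRing.Theory Num.Theory.
Local Open Scope ring_scope.

(* [bernoulli_seq m] lists B_0, ..., B_(m-1), obtained by solving for B_m the
   recurrence \sum_(k <= m) 'C(m+1, k) B_k = [m = 0], i.e. the coefficientwise
   form of (\sum_k B_k x^k / k!) * (e^x - 1) = x. *)
Fixpoint bernoulli_seq (m : nat) : seq rat :=
  if m is m'.+1 then
    let s := bernoulli_seq m' in
    rcons s (((m' == 0%N)%:R - \sum_(k < m') 'C(m'.+1, k)%:R * s`_k)
             / m'.+1%:R)
  else [::].

Definition bernoulli (m : nat) : rat := (bernoulli_seq m.+1)`_m.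

Lemma size_bernoulli_seq m : size (bernoulli_seq m) = m.
Proof. by elim: m => //= m IHm; rewrite size_rcons IHm. Qed.

Lemma nth_bernoulli_seq m k : (k < m)%N -> (bernoulli_seq m)`_k = bernoulli k.
Proof.
elim: m => // m IHm; rewrite ltnS leq_eqVlt => /predU1P[-> // | lt_km].
by rewrite -(IHm lt_km) /= nth_rcons size_bernoulli_seq lt_km.
Qed.

Lemma bernoulli_rec m :
  \sum_(k < m.+1) 'C(m.+1, k)%:R * bernoulli k = (m == 0%N)%:R.
Proof.
rewrite big_ord_recr /= binSn {2}/bernoulli /= nth_rcons size_bernoulli_seq.
rewrite ltnn eqxx [X in _ + X]mulrC divfK ?pnatr_eq0 // addrC.
under [X in _ - X]eq_bigr => k _ do rewrite nth_bernoulli_seq //.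
by rewrite subrK.
Qed.

Definition is_partition (n : nat) (lam : seq nat) : bool :=
  [&& sorted geq lam, all (leq 1) lam & sumn lam == n].

Definition phi (n : nat) (lam : seq nat) : rat :=
  ((2 * n)`!)%:R *
  \prod_(1 <= k < n.+1)
    let m := count_mem k lam in
    (m`!)%:R^-1 *
    ((4%:R ^+ k * (4%:R ^+ k - 1) * bernoulli (2 * k)) /
     ((2 * k)%:R * ((2 * k)`!)%:R)) ^+ m.

(* Words are sequences of naturals whose letters are numbered from 1. *)
Definition letter (s : seq nat) (i : nat) : nat := nth 0%N s i.-1.

(* 'S_k permutes {0, ..., k-1}; the shift gives the usual letters 1, ..., k. *)
Definition oneline (k : nat) (w : 'S_k) : seq nat :=
  [seq (w i).+1 | i <- enum 'I_k].

Definition alternating (s : seq nat) : bool :=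
  all (fun i => if odd i then (letter s i > letter s i.+1)%N
                else (letter s i < letter s i.+1)%N)
      (iota 1 (size s).-1).

Definition alternating_perms (k : nat) : {set 'S_k} :=
  [set w : 'S_k | alternating (oneline w)].

Definition hat (n : nat) (w : 'S_(2 * n)) : seq nat :=
  [seq letter (oneline w) (2 * i).-1 | i <- iota 1 n].

(* The record set, listed increasingly. *)
Definition records (b : seq nat) : seq nat :=
  [seq i <- iota 1 (size b) |
    all (fun j => (letter b j < letter b i)%N) (iota 1 i.-1)].

Definition record_partition (b : seq nat) : seq nat :=
  if records b is r1 :: r then
    sort geq (pairmap (fun x y => (y - x)%N) r1 (rcons r (size b).+1))
  else [::].

(* Main.v *)
Require Import Defs.
From HB Require Import structures.
From mathcomp Require Import all_boot all_order all_algebra all_fingroup.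
From mathcomp Require Import ring zify.
Import Order.TTheory GRing.Theory Num.Theory.
Local Open Scope ring_scope.

(** Both sides are governed by removing the largest letter of a word.

    In an alternating word of length 2n the largest letter m is the last record;
    writing the word as u m v, the word u is alternating of even length 2(n - x),
    where x is the last part of the record composition, and v is an up-down word
    of length 2x - 1.  Hence the counts N(lam) satisfy
    N(lam) = \sum_x C(2n - 1, 2x - 1) E_(2x-1) N(lam minus x), the sum being over
    the distinct parts x of lam, and (2n)! \prod_k (E_(2k-1) / (2k)!)^(m_k) / m_k!
    solves this recurrence because \sum_k 2k m_k = 2n.

    Splitting up-down words of odd length at their largest letter in the same way
    shows that their generating function satisfies T' = 1 + T^2.  On the other
    side, x tanh x = x - B(2x) + B(4x) with B(x) = x / (e^x - 1), so the Bernoulli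
    factors of phi are coefficients of tanh, which satisfies t' = 1 - t^2; the two
    agree up to sign. *)

(** * Truncated power series and the differential equation of tanh *)

(* The coefficient of x^m in tanh x. *)
Definition tanh_coef (m : nat) : rat :=
  (4%:R ^+ m.+1 - 2%:R ^+ m.+1) * bernoulli m.+1 / (m.+1)`!%:R + (m == 0%N)%:R.

Lemma fact_neq0 m : (m`!)%:R != 0 :> rat.
Proof. by rewrite pnatr_eq0 -lt0n fact_gt0. Qed.

Lemma bin_factq m i : (i <= m)%N ->
  'C(m, i)%:R = m`!%:R / (i`!%:R * (m - i)`!%:R) :> rat.
Proof.
move=> le_im; rewrite -(bin_fact le_im) !natrM mulfK //.
by rewrite mulf_neq0 ?fact_neq0.
Qed.

(** Power series are cut to polynomials; congruence modulo ['X^N] is stated with an explicit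
    cofactor [r], so that [ring] can handle the resulting identities. *)
Definition exp_trunc (N : nat) (c : rat) : {poly rat} :=
  \poly_(i < N) (c ^+ i / i`!%:R).

Definition bernoulli_trunc (N : nat) (c : rat) : {poly rat} :=
  \poly_(i < N) (c ^+ i * bernoulli i / i`!%:R).

Definition tanh_trunc (N : nat) : {poly rat} := \poly_(i < N) tanh_coef i.

Lemma dvdXnP (N : nat) (p : {poly rat}) :
  reflect (forall i, (i < N)%N -> p`_i = 0) ('X^N %| p).
Proof.
apply: (iffP idP) => [/dvdpP[q ->] i lt_iN|p0]; first by rewrite coefMXn lt_iN.
apply/dvdpP; exists (drop_poly N p); rewrite -[LHS](poly_take_drop N).
suff ->: take_poly N p = 0 by rewrite add0r.
by apply/polyP=> i; rewrite coef_take_poly coef0; case: ltnP => // /p0.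
Qed.

Lemma eqmodXn_ex (N : nat) (p q : {poly rat}) :
  (forall i, (i < N)%N -> p`_i = q`_i) -> exists r, p = q + 'X^N * r.
Proof.
move=> eq_pq; have /dvdpP[r Dr]: 'X^N %| p - q.
  by apply/dvdXnP=> i lt_iN; rewrite coefB eq_pq ?subrr.
by exists r; rewrite mulrC -Dr subrKC.
Qed.

(** By the Gauss lemma, such a factor can be cancelled modulo ['X^N]. *)
Lemma coprimeXn (N : nat) (p : {poly rat}) : p`_0 != 0 -> coprimep 'X^N p.
Proof.
move=> p0; apply: coprimep_expl; rewrite coprimep_sym -[X in coprimep p X]subr0.
by rewrite -polyC0 coprimep_XsubC rootE horner_coef0.
Qed.

Lemma exp_trunc_sqr N : exists r,
  exp_trunc N 4%:R = exp_trunc N 2%:R ^+ 2 + 'X^N * r.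
Proof.
apply: eqmodXn_ex => m lt_mN; rewrite coef_poly lt_mN expr2 coefM.
have ->: (4%:R : rat) = 2%:R + 2%:R by rewrite -natrD.
rewrite exprDn mulr_suml; apply: eq_bigr => -[i /= le_im] _.
rewrite !coef_poly !(leq_ltn_trans _ lt_mN) ?leq_subr //.
rewrite -[_ *+ 'C(_, _)]mulr_natr bin_factq //.
by field; rewrite !fact_neq0.
Qed.

(** This is [bernoulli_rec] scaled by c^m / m!: the term [- 1] removes the top summand of the Cauchy
    product and leaves the sum over i < m. *)
Lemma bernoulli_trunc_eq N c : exists r,
  bernoulli_trunc N c * (exp_trunc N c - 1) = c *: 'X + 'X^N * r.
Proof.
apply: eqmodXn_ex => m lt_mN; rewrite mulrBr mulr1 coefB coefM.
rewrite /exp_trunc /bernoulli_trunc big_ord_recr /= subnn !coef_poly.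
rewrite lt_mN (leq_ltn_trans _ lt_mN) //.
have -> : c ^+ 0 / 0`!%:R = 1 by rewrite expr0 divr1.
rewrite mulr1 addrK.
have ->: (c *: 'X)`_m = c ^+ m / m`!%:R * (m == 1)%N%:R.
  rewrite coefZ coefX; case: eqP => [->|_]; last by rewrite !mulr0.
  by rewrite expr1 divr1 !mulr1.
case: m lt_mN => [|m] lt_mN; first by rewrite big_ord0 !mulr0.
rewrite -(bernoulli_rec m) mulr_sumr; apply: eq_bigr => -[i /= le_im] _.
rewrite !coef_poly !(leq_ltn_trans _ lt_mN) ?leq_subr ?(ltnW le_im) //.
have ->: c ^+ m.+1 = c ^+ i * c ^+ (m.+1 - i) by rewrite -exprD subnKC // ltnW.
rewrite bin_factq ?(ltnW le_im) //.
by field; rewrite !fact_neq0.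
Qed.

Lemma deriv_exp_trunc N c : exists r,
  (exp_trunc N.+1 c)^`() = c *: exp_trunc N.+1 c + 'X^N * r.
Proof.
apply: eqmodXn_ex => m lt_mN; rewrite coef_deriv coefZ !coef_poly ltnS lt_mN.
rewrite ltnS (ltnW lt_mN) factS natrM exprS -[LHS]mulr_natr.
have := fact_neq0 m; have: m.+1%:R != 0 :> rat by rewrite pnatr_eq0.
by move: (m.+1%:R) (m`!%:R) => k f k0 f0; field; rewrite f0 k0.
Qed.

(** The identity is exact because the truncation orders match; the correction at m = 0 in
    [tanh_coef] provides the summand ['X]. *)
Lemma mulX_tanh_trunc N : 'X * tanh_trunc N.+1 =
  'X - bernoulli_trunc N.+2 2%:R + bernoulli_trunc N.+2 4%:R.
Proof.
apply/polyP=> m; rewrite coefXM coefD coefB coefX !coef_poly.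
case: m => [|m] /=; first by rewrite !expr0; ring.
rewrite [(m.+1 < _)%N]ltnS eqSS; case: ltnP => [_|].
  by rewrite /tanh_coef; ring.
by case: m.
Qed.

(* tanh x = (e^(2x) - 1) / (e^(2x) + 1), obtained from
   (x tanh x) (e^(2x) + 1) (e^(2x) - 1) = x (e^(2x) - 1)^2 by cancelling
   x (e^(2x) - 1), whose order at 0 is 2. *)
Lemma tanh_exp_trunc N : exists r,
  tanh_trunc N.+1 * (exp_trunc N.+2 2%:R + 1) =
  (exp_trunc N.+2 2%:R - 1) + 'X^N * r.
Proof.
have [r1 H1] := bernoulli_trunc_eq N.+2 2%:R.
have [r2 H2] := bernoulli_trunc_eq N.+2 4%:R.
have [r3 H3] := exp_trunc_sqr N.+2.
have H4 := mulX_tanh_trunc N.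
set T := tanh_trunc _ in H4 *; set e := exp_trunc _ _ in H1 H3 *.
set b2 := bernoulli_trunc _ _ in H1 H4; set b4 := bernoulli_trunc _ _ in H2 H4.
rewrite H3 in H2.
(* The constant term of [g] is 2, so [g] can be cancelled modulo ['X^N]. *)
have [g Dg]: exists g, e - 1 = 'X * g.
  have [|g ->] := @eqmodXn_ex 1 (e - 1) 0; last by exists g; rewrite add0r.
  by case=> // _; rewrite coefB coef_poly coef1 coef0 expr0 divr1 subrr.
have g0: g`_0 != 0.
  have ->: g`_0 = (e - 1)`_1 by rewrite Dg coefXM.
  by rewrite coefB coef_poly coef1.
(* What remains once the main terms 2x(e - 1) - 2x(e + 1) + 4x cancel. *)
pose r := r2 - b4 * r3 - r1 * (e + 1).
have H: 'X^2 * (g * (T * (e + 1) - (e - 1))) = 'X^2 * ('X^N * r).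
  have ->: 'X^2 * (g * (T * (e + 1) - (e - 1))) =
           ('X * T) * (('X * g) * (e + 1)) - 'X * ('X * g) * (e - 1) by ring.
  rewrite -Dg H4.
  have ->: ('X - b2 + b4) * ((e - 1) * (e + 1)) - 'X * (e - 1) * (e - 1) =
    'X * (e - 1) * 2%:R - (b2 * (e - 1)) * (e + 1)
    + (b4 * (e ^+ 2 + 'X^(N.+2) * r3 - 1)) - 'X^(N.+2) * (b4 * r3) by ring.
  rewrite H1 H2 /r -!mul_polyC !polyC_natr.
  have ->: 'X^(N.+2) = 'X^2 * 'X^N :> {poly rat} by rewrite -exprD.
  by ring.
have X2: 'X^2 != 0 :> {poly rat} by rewrite expf_neq0 ?polyX_eq0.
move/(mulfI X2): H => H.
have: 'X^N %| g * (T * (e + 1) - (e - 1)) by rewrite H dvdp_mulr.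
rewrite (Gauss_dvdpr _ (coprimeXn _ _ g0)) => /dvdpP[q Dq].
by exists q; rewrite mulrC -[LHS](subrK (e - 1)) [_ * T]mulrC Dq; ring.
Qed.

(** Differentiating t(e + 1) = e - 1 with e' = 2e yields (e + 1)^2 (t' - 1 + t^2) = 0 up to
    remainders, and (e + 1)^2 has constant term 4. *)
Lemma tanh_ode N : exists r,
  (tanh_trunc N.+2)^`() = 1 - tanh_trunc N.+2 ^+ 2 + 'X^N * r.
Proof.
have [r1 H1] := tanh_exp_trunc N.+1.
have [r2 H2] := deriv_exp_trunc N.+2 2%:R.
set T := tanh_trunc _ in H1 *; set e := exp_trunc _ _ in H1 H2.
have H3 := congr1 (@deriv _) H1.
rewrite derivM !derivD derivM derivXn derivN -!polyC1 derivC in H3.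
rewrite !addr0 subr0 polyC1 in H3.
rewrite H2 -mul_polyC polyC_natr in H3.
have XN2: 'X^(N.+2) = 'X^N * 'X^2 :> {poly rat} by rewrite -exprD addn2.
have XN1: 'X^(N.+1) = 'X^N * 'X :> {poly rat} by rewrite -exprSr.
rewrite XN2 XN1 /= in H3 H1.
set d := T^`() in H3 *; set d1 := r1^`() in H3.
have e0: ((e + 1) ^+ 2)`_0 != 0.
  by rewrite -horner_coef0 horner_exp hornerD horner_coef0 coef_poly hornerC
             expr0 divr1.
have: 'X^N %| (e + 1) ^+ 2 * (d - (1 - T ^+ 2)).
  have ->: (e + 1) ^+ 2 * (d - (1 - T ^+ 2)) =
    (e + 1) * (d * (e + 1) + T * (2%:R * e + 'X^N * 'X^2 * r2))
    + (T * (e + 1)) ^+ 2 - (e + 1) ^+ 2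
    - T * (e + 1) * (2%:R * e + 'X^N * 'X^2 * r2) by ring.
  rewrite H3 H1.
  apply/dvdpP; set a := ('X^N : {poly rat}).
  (* The quotient collects the remainders; the main terms 2e(e + 1) + (e - 1)^2 - (e + 1)^2 - 2e(e -
     1) cancel. *)
  exists ((e + 1) * ('X^2 * r2 + r1 *+ N.+1 + 'X * d1) + 2%:R * (e - 1) * 'X * r1
    + a * 'X^2 * r1 ^+ 2 - (e - 1) * 'X^2 * r2 - 2%:R * 'X * r1 * e
    - a * 'X^3 * r1 * r2).
  by ring.
rewrite (Gauss_dvdpr _ (coprimeXn _ _ e0)) => /dvdpP[q Dq].
by exists q; rewrite mulrC -Dq; ring.
Qed.

Lemma tanh_coef_rec m :
  tanh_coef m.+1 *+ m.+1 =
  (m == 0)%N%:R - \sum_(i < m.+1) tanh_coef i * tanh_coef (m - i).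
Proof.
have [r H] := tanh_ode m.+1; have /= := congr1 (fun p : {poly rat} => p`_m) H.
rewrite coef_deriv coefD coefXnM leqnn addr0 coefB coef1 coef_poly.
rewrite ltnS leqW // expr2 coefM => ->; congr (_ - _).
apply: eq_bigr => -[i /= le_im] _; rewrite !coef_poly.
by rewrite !ifT //; lia.
Qed.

(** For odd m, every product in [tanh_coef_rec] has a factor of even index at most m, which vanishes
    by induction. *)
Lemma tanh_coef_even m : ~~ odd m -> tanh_coef m = 0.
Proof.
elim/ltn_ind: m => -[|m] IHm ev_m.
  by rewrite /tanh_coef /bernoulli /= !big_ord_recr !big_ord0 /=.
have := tanh_coef_rec m; have -> /=: (m == 0)%N = false by case: m ev_m {IHm}.
rewrite big1 => [|[i /= le_im] _]; last first.
  have [od_i|ev_i] := boolP (odd i); last by rewrite IHm ?mul0r.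
  by rewrite [X in _ * X]IHm ?mulr0 //; lia.
by rewrite subr0 => /eqP; rewrite mulrn_eq0 => /eqP.
Qed.

(** * Words on a finite set and their splitting at a letter *)

Definition words {T : finType} (A : {set T}) : seq (seq T) :=
  permutations (enum A).

Lemma mem_words (T : finType) (A : {set T}) s :
  (s \in words A) = uniq s && ([set x in s] == A).
Proof.
rewrite mem_permutations; apply/idP/andP => [eq_sA | [Us /eqP <-]].
  split; first by rewrite (perm_uniq eq_sA) enum_uniq.
  by apply/eqP/setP=> x; rewrite inE (perm_mem eq_sA) mem_enum.
by apply: uniq_perm; rewrite ?enum_uniq // => x; rewrite mem_enum inE.
Qed.

Lemma words_mem {T : finType} {A : {set T}} {s} : s \in words A -> s =i A.
Proof. by rewrite mem_words => /andP[_ /eqP <-] x; rewrite inE. Qed.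

Lemma size_words {T : finType} {A : {set T}} {s} : s \in words A -> size s = #|A|.
Proof. by rewrite mem_permutations cardE => /perm_size. Qed.

Lemma words0 (T : finType) : words (set0 : {set T}) = [:: [::]].
Proof. by rewrite /words enum_set0. Qed.

Lemma cat_cons_inj (T : eqType) (m : T) u1 v1 u2 v2 :
  m \notin u1 -> m \notin u2 -> u1 ++ m :: v1 = u2 ++ m :: v2 ->
  u1 = u2 /\ v1 = v2.
Proof.
elim: u1 u2 => [|x u1 IH] [|y u2] //=; rewrite ?inE ?negb_or.
- by move=> _ _ [->].
- by move=> _ /andP[/eqP ny _] [/ny].
- by move=> /andP[/eqP nx _] _ [/esym/nx].
by move=> /andP[_ m1] /andP[_ m2] [-> /(IH _ m1 m2)[-> ->]].
Qed.

(** Cutting a word at its unique occurrence of [m] is a bijection onto triples (B, u, v), where B is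
    the set of letters of u. *)
Lemma sum_words_split (T : finType) (A : {set T}) (m : T) (F : seq T -> rat) :
  m \in A ->
  \sum_(s <- words A) F s =
  \sum_(B in powerset (A :\ m)) \sum_(u <- words B)
    \sum_(v <- words (A :\ m :\: B)) F (u ++ m :: v).
Proof.
move=> Am; pose f (B : {set T}) (p : seq T * seq T) := p.1 ++ m :: p.2.
pose ps B := [seq (u, v) | u <- words B, v <- words (A :\ m :\: B)].
have notin_m (B : {set T}) u : B \subset A :\ m -> u \in words B -> m \notin u.
  move=> sBA /words_mem ->; apply/negP=> /(subsetP sBA).
  by rewrite !inE eqxx.
have mem_ps B p :
    (p \in ps B) = (p.1 \in words B) && (p.2 \in words (A :\ m :\: B)).
  case: p => u v; apply/allpairsP/andP => /= [[[u' v'] [? ? [-> ->]]] // | [? ?]].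
  by exists (u, v).
have: perm_eq (words A) [seq f B p | B <- enum (powerset (A :\ m)), p <- ps B].
  apply: uniq_perm; first exact: permutations_uniq.
    apply: allpairs_uniq_dep; first exact: enum_uniq.
      move=> B _; apply: allpairs_uniq; rewrite ?permutations_uniq //.
      by move=> [? ?] [? ?] _ _.
    move=> x y /allpairsPdep[B1 [p1 [Bp1 pp1 ->]]].
    move=> /allpairsPdep[B2 [p2 [Bp2 pp2 ->]]] {x y}/=.
    rewrite !mem_enum !powersetE in Bp1 Bp2.
    move: pp1 pp2; rewrite !mem_ps => /andP[pu1 pv1] /andP[pu2 pv2].
    move/(cat_cons_inj _ _ _ _ _ _ (notin_m _ _ Bp1 pu1) (notin_m _ _ Bp2 pu2)).
    case: p1 p2 pu1 pu2 {pv1 pv2} => [u1 v1] [u2 v2] /= pu1 pu2 [Du ->].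
    rewrite {}Du in pu1 *.
    suff ->: B1 = B2 by [].
    by apply/setP=> x; rewrite -(words_mem pu1) -(words_mem pu2).
  move=> s; apply/idP/allpairsPdep => [As | [B [[u v] []]]].
    have ms: m \in s by rewrite (words_mem As).
    have: s \in words A by [].
    case/splitPr: ms As => u v _; rewrite mem_words cat_uniq /=.
    case/andP=> Us /eqP DA.
    move: Us; rewrite negb_or => /and3P[Uu /andP[mu /hasPn uv] /andP[mv Uv]].
    exists [set x in u], (u, v); rewrite mem_enum powersetE mem_ps.
    rewrite !mem_words Uu Uv.
    rewrite eqxx -DA; split=> //=.
      apply/subsetP=> x; rewrite !inE mem_cat => ux; rewrite ux andbT.
      by apply: contraNneq mu => <-.
    apply/eqP/setP=> x; rewrite !inE mem_cat inE.
    have [vx|] := boolP (x \in v); last by case: eqP; case: (x \in u).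
    by rewrite (uv _ vx) !orbT andbT; apply/esym; apply: contraNneq mv => <-.
  rewrite mem_enum powersetE mem_ps /= => sBA /andP[Bu Bv] ->.
  have mu := notin_m _ _ sBA Bu.
  rewrite mem_words /f cat_uniq /= negb_or; apply/andP; split.
    move: (Bu) (Bv); rewrite !mem_words => /andP[-> _] /andP[-> _] /=.
    rewrite mu (words_mem Bv) !inE eqxx !andbF /= andbT.
    by apply/hasPn=> x; rewrite (words_mem Bv) (words_mem Bu) inE => /andP[].
  apply/eqP/setP=> x; rewrite !inE mem_cat inE (words_mem Bu) (words_mem Bv) !inE.
  have [Bx|_] := boolP (x \in B); last by case: eqP => // ->.
  by have := subsetP sBA _ Bx; rewrite !inE => /andP[].
move=> /(perm_big _) ->; rewrite big_allpairs_dep big_enum /=.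
by apply: eq_bigr => B _; rewrite big_allpairs.
Qed.

(** When the inner sums depend only on the number of letters before [m], subsets of equal size can
    be grouped. *)
Lemma sum_words_split_card (T : finType) (A : {set T}) (m : T) (k : nat)
    (F : seq T -> rat) (f : nat -> rat) :
  m \in A -> #|A| = k.+1 ->
  (forall B : {set T}, B \subset A :\ m ->
    \sum_(u <- words B) \sum_(v <- words (A :\ m :\: B)) F (u ++ m :: v) =
    f #|B|) ->
  \sum_(s <- words A) F s = \sum_(i < k.+1) 'C(k, i)%:R * f i.
Proof.
move=> Am cardA Ff; have cardAm: #|A :\ m| = k.
  by move: cardA; rewrite (cardsD1 m) Am => -[].
rewrite (sum_words_split _ _ _ _ Am).
rewrite (partition_big (fun B : {set T} => inord #|B| : 'I_k.+1) xpredT) //=.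
apply: eq_bigr => i _.
have ->: 'C(k, i) = #|[set B : {set T} | B \subset A :\ m & #|B| == i]|.
  by rewrite cards_draws cardAm.
rewrite -sum1_card natr_sum mulr_suml; apply: eq_big => B.
  rewrite powersetE inE; apply: andb_id2l => sBA.
  by rewrite -val_eqE /= inordK // ltnS -cardAm subset_leq_card.
rewrite powersetE => /andP[sBA /eqP <-]; rewrite Ff // mul1r inordK //.
by rewrite ltnS -cardAm subset_leq_card.
Qed.

(** * Alternating words and up-down numbers *)

Fixpoint zigzag (down : bool) (s : seq nat) : bool :=
  if s is x :: s' then
    (if s' is y :: _ then if down then y < x else x < y else true)%N
    && zigzag (~~ down) s'
  else true.

(** The step into [m] must rise and the step out of it must fall; both demands are the same parity
    condition on [size u], void only if [u] and [v] are empty. After the fall, [v] starts with a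
    rise. *)
Lemma zigzag_cat_max b u m v :
  all (fun x => x < m)%N u -> all (fun x => x < m)%N v ->
  zigzag b (u ++ m :: v) =
  [&& zigzag b u, zigzag false v & nilp u && nilp v || (b (+) odd (size u))].
Proof.
elim: u b => [|x u IHu] b /=.
  move=> _; case: v => [|y v] //= /andP[lt_ym _].
  by rewrite lt_ym ltnNge (ltnW lt_ym); case: b; rewrite /= ?andbT ?andbF.
case/andP=> lt_xm u_lt_m v_lt_m; rewrite (IHu _ u_lt_m v_lt_m).
case: u {IHu u_lt_m} => [|y u] /=.
  rewrite lt_xm ltnNge (ltnW lt_xm).
  by case: b v {v_lt_m} => -[|y v] //=; rewrite ?andbF ?andbT.
by rewrite -!andbA; case: b; rewrite /= ?negbK.
Qed.

Lemma zigzag_nth b s : zigzag b s =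
  all (fun i => if b (+) odd i then (nth 0 s i.+1 < nth 0 s i)%N
                else (nth 0 s i < nth 0 s i.+1)%N) (iota 0 (size s).-1).
Proof.
elim: s b => [|x [|y s] IHs] b //.
have ->: zigzag b [:: x, y & s] =
  (if b then y < x else x < y)%N && zigzag (~~ b) (y :: s) by [].
rewrite IHs [RHS]/= addbF; congr (_ && _).
rewrite [iota 1 _](iotaDl 1 0) all_map; apply: eq_all => i /=.
by rewrite addbN addNb.
Qed.

Lemma alternatingE s : alternating s = zigzag true s.
Proof.
rewrite zigzag_nth /alternating (iotaDl 1 0) all_map.
by apply: eq_all => i.
Qed.

(* For odd k, the number of up-down permutations of k letters; the sign turns
   coefficients of tanh into coefficients of tan. *)
Definition updown_num (k : nat) : rat :=
  k`!%:R * (-1) ^+ k./2 * tanh_coef k.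

(* The words over 'I_N are shifted to letters numbered from 1, as in [oneline]. *)
Definition letters {N : nat} (s : seq 'I_N) : seq nat :=
  [seq (val x).+1 | x <- s].

Lemma set_ord_max {N : nat} {A : {set 'I_N}} k : #|A| = k.+1 ->
  exists2 m, m \in A &
    forall (B : {set _}) s, B \subset A :\ m -> s \in words B ->
      all (fun x => x < m.+1)%N (letters s).
Proof.
move=> cardA; have /card_gt0P[x0 Ax0]: (0 < #|A|)%N by rewrite cardA.
have [m Am max_m] := arg_maxnP (fun x : 'I_N => val x) Ax0.
exists m => // B s sBA Bs; rewrite all_map; apply/allP=> x.
rewrite (words_mem Bs).
move/(subsetP sBA); rewrite !inE /= => /andP[neq_xm /max_m le_xm].
by rewrite ltnS ltn_neqAle neq_xm.
Qed.

Lemma sum_words_pair (T : finType) (B C : {set T}) (P Q : pred (seq T)) :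
  \sum_(u <- words B) \sum_(v <- words C) (P u && Q v)%:R =
  (\sum_(u <- words B) (P u)%:R) * \sum_(v <- words C) (Q v)%:R :> rat.
Proof.
rewrite big_distrlr /=; apply: eq_bigr => u _; apply: eq_bigr => v _.
by rewrite -natrM mulnb.
Qed.

(** Splitting at the largest letter gives the recurrence [tanh_coef_rec] up to signs. The set [A] is
    arbitrary because the induction passes to subsets. *)
Lemma count_updown {N : nat} (A : {set 'I_N}) : odd #|A| ->
  \sum_(s <- words A) (zigzag false (letters s))%:R = updown_num #|A|.
Proof.
have [n] := ubnP #|A|; elim: n A => // n IHn A /ltnSE leAn.
case cardA: #|A| => [|k] //= od_k.
have [m Am max_m] := set_ord_max k cardA.
have cardAm: #|A :\ m| = k by move: cardA; rewrite (cardsD1 m) Am => -[].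
(* In an up-down word the maximum cannot follow a prefix of even length, except in a word of one
   letter. *)
pose f i := if odd i then updown_num i * updown_num (k - i) else (k == 0)%N%:R.
rewrite (@sum_words_split_card _ _ m k _ f) //; last first.
  move=> B sBA; have leBk: (#|B| <= k)%N by rewrite -cardAm subset_leq_card.
  have cardC: #|A :\ m :\: B| = (k - #|B|)%N.
    by rewrite cardsD (setIidPr sBA) cardAm.
  under eq_big_seq => u Bu.
    under eq_big_seq => v Bv.
      rewrite /letters map_cat zigzag_cat_max; last 2 first.
      - exact: max_m sBA Bu.
      - by apply: (max_m _ _ _ Bv); rewrite subsetDl.
      rewrite /nilp !size_map (size_words Bu) (size_words Bv) cardC.
      over.
    over.
  rewrite /f; case od_B: (odd #|B|).
    rewrite -IHn ?od_B //; last by lia.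
    rewrite -cardC -IHn; last 2 first.
    - by rewrite cardC; lia.
    - by rewrite cardC; lia.
    by rewrite -sum_words_pair; do 2!apply: eq_bigr => ? _; rewrite orbT andbT.
  have [k0|k_gt0] := posnP k.
    have -> : B = set0 by apply/eqP; rewrite -cards_eq0; lia.
    have -> : A :\ m :\: set0 = set0.
      by apply/eqP; rewrite -cards_eq0 setD0 cardAm k0.
    by rewrite !words0 !big_seq1 cards0 k0.
  rewrite big1_seq // => u _; rewrite big1_seq // => v _.
  have ->: (#|B| == 0)%N && (k - #|B| == 0)%N = false by lia.
  by rewrite !andbF.
have := tanh_coef_rec k; rewrite -[LHS]mulr_natr => rec.
have ->: updown_num k.+1 = k`!%:R * (-1) ^+ k./2 * (tanh_coef k.+1 * k.+1%:R).
  rewrite /updown_num factS natrM (_ : k.+1./2 = k./2); last by lia.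
  by ring.
rewrite {}rec; have [k0|k_gt0] := posnP k.
  by rewrite k0 !big_ord_recr !big_ord0 /= /f k0 /= tanh_coef_even.
rewrite sub0r mulrN mulr_sumr -sumrN; apply: eq_bigr => -[i /= le_ik] _.
rewrite /f; case: ifP => [od_i|/negbT ev_i]; last first.
  by rewrite [tanh_coef i]tanh_coef_even // (gtn_eqF k_gt0) mul0r !mulr0 oppr0.
rewrite /updown_num bin_factq //.
(* Here k is even and i is odd; the extra 1 absorbs the minus sign of t' = 1 - t^2. *)
have ->: k./2 = (i./2 + (k - i)./2).+1 by lia.
rewrite exprS exprD; field.
by rewrite !fact_neq0.
Qed.

(** A count is nonnegative, so the sign in [updown_num] can only turn [tanh_coef k] into its
    absolute value. *)
Lemma updown_num_norm k : odd k -> updown_num k = k`!%:R * `|tanh_coef k|.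
Proof.
move=> od_k; have: 0 <= updown_num k.
  have <-: #|[set: 'I_k]| = k by rewrite cardsT card_ord.
  rewrite -count_updown; last by rewrite cardsT card_ord.
  by apply: sumr_ge0 => s _; rewrite ler0n.
by move/ger0_norm <-; rewrite !normrM normrX normrN1 expr1n normr_nat mulr1.
Qed.

(** * Letters at odd positions and their records *)

Fixpoint evens (s : seq nat) : seq nat :=
  if s is x :: s' then x :: (if s' is _ :: s'' then evens s'' else [::])
  else [::].

Lemma evens_cat n u v : size u = (2 * n)%N -> evens (u ++ v) = evens u ++ evens v.
Proof.
elim: n u => [|n IHn] [|x [|y u]] //= size_u; try lia.
by rewrite IHn //; lia.
Qed.

Lemma evens_nth n s : size s = (2 * n)%N ->
  evens s = [seq letter s (2 * i).-1 | i <- iota 1 n].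
Proof.
elim: n s => [|n IHn] [|x [|y s]] //= size_s; try lia.
congr (_ :: _); rewrite IHn; last by lia.
rewrite [in RHS](iotaDl 1 1) -map_comp; apply/eq_in_map => i.
rewrite mem_iota => /andP[i_gt0 _]; rewrite /letter /=.
by have ->: (2 * (1 + i)).-1.-1 = (2 * i).-1.-1.+2 by lia.
Qed.

Lemma size_evens s : size (evens s) = uphalf (size s).
Proof.
have [n] := ubnP (size s); elim: n s => // n IHn [|x [|y s]] //= lt_sn.
by rewrite IHn //; lia.
Qed.

Lemma evens_sub s : {subset evens s <= s}.
Proof.
have [n] := ubnP (size s); elim: n s => // n IHn [|x [|y s]] //= lt_sn z //.
rewrite !inE; case/orP=> [-> // | /IHn ->]; last by lia.
by rewrite !orbT.
Qed.

Lemma all_evens (P : pred nat) s : all P s -> all P (evens s).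
Proof. by move=> /allP sP; apply/allP=> x /evens_sub/sP. Qed.

(** The maximum is a record, no later letter is one, and the earlier records depend on [c] alone. *)
Lemma records_cat_max c m d :
  all (fun x => x < m)%N c -> all (fun x => x < m)%N d ->
  records (c ++ m :: d) = rcons (records c) (size c).+1.
Proof.
move=> /allP c_lt_m /allP d_lt_m.
rewrite /records size_cat /= iotaD filter_cat add1n /= -cats1.
have letter_c i : (0 < i <= size c)%N -> letter (c ++ m :: d) i = letter c i.
  by move=> i_c; rewrite /letter nth_cat ifT //; lia.
have letter_m : letter (c ++ m :: d) (size c).+1 = m.
  by rewrite /letter nth_cat ltnn subnn.
congr (_ ++ _).
  apply: eq_in_filter => i; rewrite mem_iota => i_c; apply: eq_in_all => j.
  by rewrite mem_iota => j_i; rewrite !letter_c //; lia.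
rewrite ifT; last first.
  apply/allP=> /= j; rewrite mem_iota letter_m => j_c.
  rewrite letter_c; last by lia.
  have lt_jc: (j.-1 < size c)%N by lia.
  exact/c_lt_m/mem_nth.
congr cons; apply/eqP; rewrite -[_ == _]negbK -has_filter; apply/hasPn=> /= i.
rewrite mem_iota => i_d; apply/negP=> /allP/(_ (size c).+1).
rewrite mem_iota letter_m => /(_ ltac:(lia)).
have /d_lt_m: letter (c ++ m :: d) i \in d.
  rewrite /letter nth_cat ifF; last by lia.
  have ->: (i.-1 - size c = (i.-2 - size c).+1)%N by lia.
  have lt_id: (i.-2 - size c < size d)%N by lia.
  exact: mem_nth.
by move/ltnW; rewrite ltnNge => ->.
Qed.

(** The record composition, that is, the parts before sorting. *)
Definition record_gaps (b : seq nat) : seq nat :=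
  if records b is r1 :: r then
    pairmap (fun x y => (y - x)%N) r1 (rcons r (size b).+1)
  else [::].

Lemma record_partitionE b : record_partition b = sort geq (record_gaps b).
Proof. by rewrite /record_partition /record_gaps; case: records. Qed.

Lemma pairmap_rcons (T1 T2 : Type) (f : T1 -> T1 -> T2) x s y :
  pairmap f x (rcons s y) = rcons (pairmap f x s) (f (last x s) y).
Proof. by elim: s x => //= z s IHs x; rewrite IHs. Qed.

(** The closing value [(size c).+1] used for the gaps of [c] is exactly the position of [m], so
    these gaps are unchanged and one is added. *)
Lemma record_gaps_cat_max c m d :
  all (fun x => x < m)%N c -> all (fun x => x < m)%N d ->
  record_gaps (c ++ m :: d) = rcons (record_gaps c) (size d).+1.
Proof.
move=> c_lt_m d_lt_m; rewrite /record_gaps (records_cat_max _ _ _ c_lt_m d_lt_m).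
have -> : ((size (c ++ m :: d)).+1 = (size c).+1 + (size d).+1)%N.
  by rewrite size_cat /=; lia.
case: c {c_lt_m d_lt_m} => [|x c]; first by rewrite /= addKn.
have [r ->]: exists r, records (x :: c) = 1%N :: r by eexists.
by rewrite rcons_cons /= pairmap_rcons last_rcons addKn.
Qed.

Lemma perm_rcons_rem (T : eqType) (g s : seq T) x :
  perm_eq (rcons g x) s = (x \in s) && perm_eq g (rem x s).
Proof.
rewrite perm_rcons; have [sx|s'x] := boolP (x \in s).
  by rewrite (permPr (perm_to_rem sx)) perm_cons.
by apply/negP=> /perm_mem/(_ x); rewrite inE eqxx (negPf s'x).
Qed.

(** * Counting alternating words by record partition *)

(** The claimed count divided by (2n)!. The bound [K] is independent of [lam], so that it stays
    fixed when a part is removed. *)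
Definition record_weight (K : nat) (lam : seq nat) : rat :=
  \prod_(1 <= k < K) let m := count_mem k lam in
    (m`!)%:R^-1 * (updown_num (2 * k).-1 / (2 * k)`!%:R) ^+ m.

(** Only the factor at k = x changes, and m / m! = 1 / (m - 1)! for the multiplicity m of x. *)
Lemma record_weight_rem K lam x : x \in lam -> (0 < x < K)%N ->
  (count_mem x lam)%:R * record_weight K lam =
  updown_num (2 * x).-1 / (2 * x)`!%:R * record_weight K (rem x lam).
Proof.
move=> lam_x xK; rewrite /record_weight.
rewrite !(bigD1_seq x) /= ?mem_index_iota ?iota_uniq // !mulrA.
have ->: count_mem x lam = (count_mem x (rem x lam)).+1.
  by rewrite (seq.permP (perm_to_rem lam_x)) /= eqxx.
congr (_ * _).
  set m := count_mem x _; rewrite factS natrM exprS.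
  have := fact_neq0 m; have: m.+1%:R != 0 :> rat by rewrite pnatr_eq0.
  move: (m.+1%:R) (m`!%:R) (updown_num _ / _) => k f y k0 f0.
  by field; rewrite f0 k0.
apply: eq_bigr => k neq_kx; rewrite (seq.permP (perm_to_rem lam_x)) /=.
by rewrite eq_sym (negPf neq_kx).
Qed.

Lemma sumn_count n lam : all (fun x => 0 < x <= n)%N lam ->
  sumn lam = (\sum_(x < n) x.+1 * count_mem x.+1 lam)%N.
Proof.
elim: lam => [|y lam IHlam] /=; first by rewrite big1 // => x _; rewrite muln0.
case/andP=> y_n /IHlam ->; under [RHS]eq_bigr do rewrite mulnDr.
rewrite [RHS]big_split; congr addn.
have lt_yn : (y.-1 < n)%N by lia.
rewrite (bigD1 (Ordinal lt_yn)) //= big1 => [|x neq_xy].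
  by rewrite prednK ?eqxx ?muln1 ?addn0 //; lia.
case: eqP => [Dy|_]; last by rewrite muln0.
by case/eqP: neq_xy; apply: val_inj; rewrite /= Dy.
Qed.

Lemma sum_ord_double (R : nmodType) n (F : nat -> R) :
  \sum_(i < 2 * n) F i = \sum_(j < n) (F (2 * j)%N + F (2 * j).+1).
Proof.
elim: n => [|n IHn]; first by rewrite muln0 !big_ord0.
by rewrite mulnS add2n !big_ord_recr /= IHn addrA.
Qed.

(** Induction on the number of parts, removing the last record; [A] is arbitrary because the prefix
    u ranges over words on its subsets. Comparing up to permutation lets the last gap be any part of
    [lam]. *)
Lemma count_records {N : nat} K (A : {set 'I_N}) lam :
  all (fun x => 0 < x < K)%N lam -> #|A| = (2 * sumn lam)%N ->
  \sum_(s <- words A)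
    (zigzag true (letters s) && perm_eq (record_gaps (evens (letters s))) lam)%:R
  = (2 * sumn lam)`!%:R * record_weight K lam.
Proof.
have [n] := ubnP (size lam); elim: n lam A => // n IHn lam A /ltnSE le_lam_n.
move=> lamK; have lam_gt0 x : x \in lam -> (0 < x < K)%N by move/(allP lamK).
have [->|lam_n0] := eqVneq lam [::].
  move=> /eqP; rewrite cards_eq0 => /eqP->; rewrite words0 big_seq1 /= mul1r.
  by rewrite /record_weight big1_seq // => k _ /=; rewrite invr1 mul1r.
have: (0 < sumn lam)%N.
  case: lam lam_n0 lam_gt0 {le_lam_n lamK} => //= x s _ /(_ x).
  by rewrite mem_head; lia.
set p := sumn lam => p_gt0 cardA.
have [k Dk] : exists k, (2 * p = k.+1)%N by exists (2 * p).-1; lia.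
rewrite Dk in cardA.
have [m Am max_m] := set_ord_max k cardA.
have cardAm: #|A :\ m| = k by move: cardA; rewrite (cardsD1 m) Am => -[].
(* A prefix of length i = 2(p - x) leaves 2x - 1 letters after the maximum, so the last gap is x = p
   - i/2. *)
pose f i := if ~~ odd i && ((p - i./2)%N \in lam) then
  (2 * sumn (rem (p - i./2)%N lam))`!%:R * record_weight K (rem (p - i./2)%N lam)
    * updown_num (k - i) else 0.
have sumn_rem x : x \in lam -> (x + sumn (rem x lam))%N = p.
  by move=> lam_x; rewrite /p (perm_sumn (perm_to_rem lam_x)).
rewrite (@sum_words_split_card _ _ m k _ f) //; last first.
  move=> B sBA; have leBk: (#|B| <= k)%N by rewrite -cardAm subset_leq_card.
  have cardC: #|A :\ m :\: B| = (k - #|B|)%N.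
    by rewrite cardsD (setIidPr sBA) cardAm.
  pose x := (p - #|B|./2)%N.
  pose good (s : seq 'I_N) := zigzag true (letters s) &&
    perm_eq (record_gaps (evens (letters s))) (rem x lam).
  have key u v : u \in words B -> v \in words (A :\ m :\: B) ->
      zigzag true (letters (u ++ m :: v)) &&
        perm_eq (record_gaps (evens (letters (u ++ m :: v)))) lam =
      [&& ~~ odd #|B|, x \in lam, good u & zigzag false (letters v)].
    move=> Bu Bv; have Lu := max_m _ _ sBA Bu.
    have Lv : all (fun y => y < m.+1)%N (letters v).
      by apply: (max_m _ _ _ Bv); rewrite subsetDl.
    have size_u : size (letters u) = #|B| by rewrite size_map (size_words Bu).
    have size_v : size (letters v) = (k - #|B|)%N.
      by rewrite size_map (size_words Bv).
    have ->: letters (u ++ m :: v) = letters u ++ m.+1 :: letters v.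
      by rewrite /letters map_cat.
    rewrite zigzag_cat_max // /nilp size_u size_v.
    have ->: (#|B| == 0)%N && (k - #|B| == 0)%N = false by lia.
    rewrite /=; case ev_B: (odd #|B|); first by rewrite !andbF.
    rewrite (@evens_cat #|B|./2) ?size_u; last by lia.
    (* The prefix has even length, so the maximum is kept and [evens] skips the first letter of
       v. *)
    have ->: evens (m.+1 :: letters v) = m.+1 :: evens (behead (letters v)).
      by case: (letters v).
    rewrite record_gaps_cat_max; last 2 first.
    - exact: all_evens.
    - by apply/all_evens/allP=> y /mem_behead/(allP Lv).
    rewrite size_evens size_behead size_v.
    have ->: (uphalf (k - #|B|).-1).+1 = x by lia.
    rewrite perm_rcons_rem /good andbT /=.
    by do 2!case: zigzag; rewrite ?andbF ?andbT.
  rewrite /f -/x; under eq_big_seq => u Bu do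
    under eq_big_seq => v Bv do rewrite key //.
  case: ifPn => [/andP[ev_B lam_x] | /negPf not_x]; last first.
    rewrite big1 // => u _; rewrite big1 // => v _.
    by rewrite andbA not_x.
  have S := sumn_rem _ lam_x.
  rewrite -(IHn _ B); last 3 first.
  - by rewrite size_rem //; case: (lam) lam_n0 le_lam_n.
  - by apply/allP=> y /mem_rem/lam_gt0.
  - by lia.
  rewrite -cardC -count_updown; last by rewrite cardC; lia.
  by rewrite -sum_words_pair ev_B lam_x.
(* Only even prefix lengths contribute; reversing the order indexes the terms by the part x = j +
   1. *)
have := sum_ord_double _ p (fun i => 'C(k, i)%:R * f i); rewrite Dk => ->.
rewrite (reindex_inj rev_ord_inj) /=.
(* With q = p - x, C(k, 2q) (2q)! = k! / (2x - 1)!, and [record_weight_rem] then produces 2x times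
   the multiplicity of x. *)
have E (j : 'I_p) : 'C(k, 2 * (p - j.+1))%:R * f (2 * (p - j.+1))%N
   + 'C(k, (2 * (p - j.+1)).+1)%:R * f (2 * (p - j.+1)).+1 =
   k`!%:R * record_weight K lam * (2 * (j.+1 * count_mem j.+1 lam))%:R.
  have lt_jp := ltn_ord j.
  rewrite /f !oddS oddM /= mulr0 addr0 mul2n doubleK -mul2n subKn //.
  case: ifPn => [lam_x | /count_memPn ->]; last by rewrite !muln0 !mulr0.
  have S := sumn_rem _ lam_x.
  have ->: (p - j.+1 = sumn (rem j.+1 lam))%N by lia.
  set q := sumn _ in S *.
  rewrite bin_factq; last by lia.
  have ->: (k - 2 * q = (2 * j.+1).-1)%N by lia.
  have := record_weight_rem K lam _ lam_x (lam_gt0 _ lam_x).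
  have ->: (2 * j.+1)`! = (2 * j.+1 * (2 * j.+1).-1`!)%N by rewrite mulnS.
  rewrite mulnA !natrM.
  have := fact_neq0 (2 * q); have := fact_neq0 (2 * j.+1).-1.
  have: (2%:R * j.+1%:R != 0 :> rat) by rewrite -natrM pnatr_eq0.
  move: (_`!%:R) (_`!%:R) (_`!%:R) (2%:R * j.+1%:R) => a b c d d0 c0 b0 R.
  set W := record_weight K lam in R *; set y := (count_mem _ _)%:R in R *.
  have ->: a * W * (d * y) = a * d * (y * W) by ring.
  by rewrite R; field; rewrite b0 c0 d0.
(* The factors 2x m_x add up to 2p = k + 1, and k! (k + 1) = (2p)!. *)
rewrite (eq_bigr _ (fun j _ => E j)) -mulr_sumr -natr_sum -big_distrr /=.
rewrite -sumn_count -/p; last first.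
  apply/allP=> x lam_x; have := sumn_rem _ lam_x; have := lam_gt0 _ lam_x.
  by lia.
by rewrite Dk factS natrM; ring.
Qed.

(** * Permutations in one-line notation and the conclusion *)

Lemma card_perm_words k (P : pred (seq 'I_k)) :
  #|[set w : 'S_k | P [seq w i | i <- enum 'I_k]]|%:R =
  \sum_(s <- words [set: 'I_k]) (P s)%:R :> rat.
Proof.
have: perm_eq (words [set: 'I_k]) [seq [seq w i | i <- enum 'I_k] | w : 'S_k].
  apply: uniq_perm; first exact: permutations_uniq.
    rewrite map_inj_uniq ?enum_uniq // => w1 w2 /eq_in_map eq_w.
    by apply/permP=> i; apply: eq_w; rewrite mem_enum.
  move=> s; apply/idP/imageP => [ws | [w _ ->]]; last first.
    rewrite mem_words map_inj_uniq ?enum_uniq; last exact: perm_inj.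
    apply/eqP/setP=> i; rewrite !inE; apply/mapP.
    by exists (w^-1%g i); rewrite ?mem_enum ?permKV.
  have size_s : size s = k by rewrite (size_words ws) cardsT card_ord.
  have Us : uniq s by move: ws; rewrite mem_words => /andP[].
  (* A word without repetition is an injective tuple, hence the one-line notation of a
     permutation. *)
  pose t := Tuple (introT eqP size_s).
  have t_inj: injective (tnth t) by apply/tuple_uniqP.
  exists (perm t_inj) => //; rewrite -[LHS](map_tnth_enum t).
  by apply: eq_map => i; rewrite permE.
move=> /(perm_big _) ->; rewrite big_image /= -sum1dep_card natr_sum.
by rewrite big_mkcond; apply: eq_bigr => w _; case: (P _).
Qed.

Theorem theorem3p2 (n : nat) (hn : (1 <= n)%N) (lam : seq nat)
    (hlam : is_partition n lam) :
  `|phi n lam| =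
  #|[set w in alternating_perms (2 * n) | record_partition (hat w) == lam]|%:R.
Proof.
have /and3P[lam_sorted /allP lam_gt0 /eqP Dn] := hlam.
have lamK: all (fun x => 0 < x < n.+1)%N lam.
  apply/allP=> x lam_x; rewrite lam_gt0 //= ltnS -Dn.
  by rewrite (perm_sumn (perm_to_rem lam_x)) leq_addr.
have ->: `|phi n lam| = (2 * n)`!%:R * record_weight n.+1 lam.
  rewrite /phi normrM normr_nat normr_prod; congr (_ * _).
  rewrite /record_weight big_nat_cond [RHS]big_nat_cond; apply: eq_bigr => k.
  rewrite andbT => /andP[k_gt0 _] /=.
  rewrite normrM normrX normfV normr_nat; congr (_ * _ ^+ _).
  rewrite updown_num_norm; last by lia.
  have [j Dj]: exists j, (2 * k = j.+2)%N by exists (2 * k).-2; lia.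
  (* This puts the factor of [phi] in the form of [tanh_coef] at index 2k - 1. *)
  have ->: 4%:R ^+ k * (4%:R ^+ k - 1) = 4%:R ^+ (2 * k) - 2%:R ^+ (2 * k) :> rat.
    have ->: 2%:R ^+ (2 * k) = 4%:R ^+ k :> rat by rewrite exprM -natrX.
    by rewrite mul2n -addnn exprD; ring.
  rewrite Dj /= /tanh_coef /= addr0 [(j.+2)`!]factS natrM.
  rewrite !normrM !normfV !normrM !normr_nat.
  have := fact_neq0 j.+1; have: j.+2%:R != 0 :> rat by rewrite pnatr_eq0.
  move: (j.+2%:R) ((j.+1)`!%:R) => a b a0 b0.
  by field; rewrite a0 b0.
have := @count_records (2 * n) n.+1 [set: 'I_(2 * n)] lam lamK.
rewrite Dn cardsT card_ord => <- //; rewrite -card_perm_words.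
congr (_%:R); apply: eq_card => w; rewrite !inE alternatingE.
have ->: letters [seq w i | i <- enum 'I_(2 * n)] = oneline w.
  by rewrite /letters -map_comp.
congr (_ && _); rewrite record_partitionE.
have <-: evens (oneline w) = hat w.
  by rewrite (@evens_nth n) // size_map size_enum_ord.
have geq_trans: transitive geq by move=> y x z /= xy yz; exact: leq_trans yz xy.
have geq_total: total geq by move=> x y; exact: leq_total.
have geq_anti: antisymmetric geq by move=> x y; rewrite andbC => /anti_leq.
(* As [lam] is its own sorted form, equality after sorting is equality up to permutation. *)
rewrite -[in RHS](sorted_sort geq_trans lam_sorted).
by apply/idP/eqP => /(perm_sortP geq_total geq_trans geq_anti).
Qed.
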